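(* Consider the following construction. Fix a finite alphabet $\mathcal{A}_0$ and sequences of positive integers $(k_n)_{n\ge0}$, $(r_n)_{n\ge0}$ with $r_n\le 2k_n$. Let $\mathcal{A}_1=\mathcal{A}_0$ and let $\tau_0\colon\mathcal{A}_1^*\to\mathcal{A}_0^*$ be the identity. For $n\ge1$, once $\mathcal{A}_n$ is defined, fix a primitive word $v_nu_n\in\mathcal{A}_n^*$ with $|u_n|=|v_n|=r_n$, let $W_n$ be the set of words $w\in\mathcal{A}_n^*$ that begin with $u_n$, end with $v_n$, and satisfy $|w|_a=k_n$ for every $a\in\mathcal{A}_n$, let $\mathcal{A}_{n+1}$ be an alphabet and $\tau_n\colon\mathcal{A}_{n+1}\to W_n$ a bijection, extended to a substitution $\tau_n\colon\mathcal{A}_{n+1}^*\to\mathcal{A}_n^*$ (the choices being such that the construction is possible). For $n\ge1$ let $a_n$ be the first letter of $u_n$, so that every $\tau_n(a)$ begins with $a_n$, and let $\mathbf{x}=\lim_{n\to\infty}\tau_0\circ\tau_1\circ\cdots\circ\tau_n(a_{n+1})$. Then $\mathbf{x}$ is factor-balanced. Moreover, there exists a choice of the sequences $(r_n)_{n\ge0}$, $(k_n)_{n\ge0}$ (together with the other choices in the construction) such that $\mathbf{x}$ has exponential-growth factor complexity.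
   Context: A word is primitive if it is not of the form $z^j$ with $j\ge2$. $|w|_a$ is the number of occurrences of $a$ in $w$. An infinite word $\mathbf{x}$ is factor-balanced if for each finite word $w$ there is $C_w>0$ with $\big||u|_w-|v|_w\big|\le C_w$ for all factors $u,v$ of $\mathbf{x}$ of equal length (occurrences counted with overlaps). Exponential-growth factor complexity means $\lim_{n\to\infty}\frac1n\log p_{\mathbf{x}}(n)>0$, where $p_{\mathbf{x}}(n)$ is the number of distinct length-$n$ factors of $\mathbf{x}$. *)

(* Defs.v *)
From HB Require Import structures.
From mathcomp Require Import all_boot all_order all_algebra.
From mathcomp Require Import all_classical all_reals all_analysis.

Set Implicit Arguments.
Unset Strict Implicit.
Unset Printing Implicit Defensive.

Import Order.TTheory GRing.Theory Num.Theory.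
Import numFieldNormedType.Exports.

Local Open Scope classical_set_scope.
Local Open Scope nat_scope.

Definition wpow (A : Type) (z : seq A) (j : nat) : seq A := flatten (nseq j z).

(* The empty word is not primitive, being the square of itself. *)
Definition primitive_word (A : Type) (w : seq A) : Prop :=
  forall (z : seq A) (j : nat), 2 <= j -> w <> wpow z j.

(* Counts the starting positions [0 <= i <= size u], so that overlapping
   occurrences are all counted (and the empty word occurs [size u + 1] times). *)
Definition occ (A : eqType) (w u : seq A) : nat :=
  count (fun i => prefix w (drop i u)) (iota 0 (size u).+1).

Definition is_factor (A : Type) (x : nat -> A) (u : seq A) : Prop :=
  exists i : nat, u = mkseq (fun j => x (i + j)) (size u).

Definition factor_balanced (A : eqType) (x : nat -> A) : Prop :=
  forall w : seq A, exists2 C : nat, 0 < C &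
    forall u v : seq A, is_factor x u -> is_factor x v -> size u = size v ->
      (`|(occ w u)%:Z - (occ w v)%:Z| <= C%:Z)%R.

Definition factor_complexity (A : finType) (x : nat -> A) (n : nat) : nat :=
  #|[pred u : n.-tuple A | `[< is_factor x u >] ]|.

Definition exponential_complexity (R : realType) (A : finType) (x : nat -> A) :
    Prop :=
  exists2 h : R, (0 < h)%R &
    ((n%:R)^-1 * ln (factor_complexity x n)%:R : R)%R @[n --> \oo] --> h.

Definition substitution (A B : Type) (f : A -> seq B) (w : seq A) : seq B :=
  flatten (map f w).

Definition word_limit (A : eqType) (w : nat -> seq A) (x : nat -> A) : Prop :=
  forall m : nat, \forall n \near \oo, prefix (mkseq x m) (w n).

(* [A_0] and [A_1] are both definitionally equal to [A0]; the values of [B] at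
   [0] and [1] are never used. *)
Definition alphabet (A0 : finType) (B : nat -> finType) (n : nat) : finType :=
  match n with
  | 0 | 1 => A0
  | _ => B n
  end.

Definition block_words (A : eqType) (u v : seq A) (k : nat) : set (seq A) :=
  [set w | [/\ prefix u w, suffix v w & forall a : A, count_mem a w = k]].

(* The words [cu n], [cv n] and the letter [ca n] are meaningful for [n >= 1]
   only; their values at [0] are unconstrained and never used. *)
Record construction (A0 : finType) := Construction {
  ck : nat -> nat;
  cr : nat -> nat;
  ck_gt0 : forall n, 0 < ck n;
  cr_gt0 : forall n, 0 < cr n;
  cr_le : forall n, cr n <= 2 * ck n;
  cB : nat -> finType;
  cu : forall n, seq (alphabet A0 cB n);
  cv : forall n, seq (alphabet A0 cB n);
  ca : forall n, alphabet A0 cB n;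
  ctau : forall n, alphabet A0 cB n.+1 -> seq (alphabet A0 cB n);
  size_cu : forall n, 1 <= n -> size (cu n) = cr n;
  size_cv : forall n, 1 <= n -> size (cv n) = cr n;
  cvu_primitive : forall n, 1 <= n -> primitive_word (cv n ++ cu n);
  ca_first : forall n, 1 <= n -> ohead (cu n) = Some (ca n);
  ctau0 : forall a : A0, ctau (n := 0) a = [:: a];
  ctau_bij : forall n, 1 <= n ->
    set_bij [set: alphabet A0 cB n.+1]
            (block_words (cu n) (cv n) (ck n)) (@ctau n)
}.

Fixpoint tau_comp (A0 : finType) (c : construction A0) (n : nat) :
    seq (alphabet A0 (cB c) n.+1) -> seq A0 :=
  match n with
  | 0 => substitution (@ctau A0 c 0)
  | m.+1 => fun w => tau_comp (substitution (@ctau A0 c m.+1) w)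
  end.

Definition is_limit_word (A0 : finType) (c : construction A0) (x : nat -> A0) :
    Prop :=
  word_limit (fun n => tau_comp [:: ca c n.+1]) x.

(* Main.v *)
(* Write [s_n] for [tau_0 o ... o tau_n]. The images [s_n(a)] have a common length
   [L_n], and [L_n] tends to infinity because primitivity of [v_n u_n] forces
   every alphabet to have two letters.

   Balance: once [L_m >= |w|], all blocks of level [m+1] share a prefix of length
   [|w|], so the number of occurrences of [w] starting in such a block depends
   only on its letter; a block of level [m+2] uses each letter equally often, so
   this number is the same for all blocks of level [m+2].

   Exponential complexity: take [r_n = 1], [k_1 = 512] and [k_n = 1] for [n >= 2].
   If [d_n = |A_n|] then [d_(n+1) >= (d_n - 2)! >= (d_n / 16)^(d_n)], whence
   [log d_(n+1) / L_n] stays bounded below; since the [d_(n+1)] blocks of level [n]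
   are distinct factors of length [L_n], so does [log p(n) / n] along [L_n], and
   the limit exists by subadditivity (Fekete). *)
Require Import Defs.
From HB Require Import structures.
From mathcomp Require Import all_boot all_order all_algebra.
From mathcomp Require Import all_classical all_reals all_analysis.
From mathcomp Require Import zify.

Set Implicit Arguments.
Unset Strict Implicit.
Unset Printing Implicit Defensive.

Import Order.TTheory GRing.Theory Num.Theory.
Import numFieldNormedType.Exports.

Local Open Scope nat_scope.

(** * Letter counts and sums over consecutive blocks *)

Lemma sum_count_mem (A : finType) (g : A -> nat) (y : seq A) :
  \sum_(b <- y) g b = \sum_(b : A) count_mem b y * g b.
Proof.
elim: y => [|c y IHy]; first by rewrite big_nil big1.
rewrite big_cons IHy /=.
under [RHS]eq_bigr => b _ do rewrite mulnDl.
rewrite big_split /=; congr (_ + _).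
by rewrite (bigD1 c) //= eqxx mul1n big1 ?addn0 // => b; rewrite eq_sym => /negPf->.
Qed.

Lemma size_constant_count (A : finType) (k : nat) (y : seq A) :
  (forall a, count_mem a y = k) -> size y = #|A| * k.
Proof.
move=> yk; rewrite -(sum_nat_const _ k) -sum1_size sum_count_mem.
by apply: eq_bigr => a _; rewrite muln1 yk.
Qed.

Lemma sum_ord_mul (F : nat -> nat) n k :
  \sum_(i < n * k) F i = \sum_(i < n) \sum_(j < k) F (i * k + j).
Proof.
elim: n => [|n IHn]; first by rewrite !big_ord0.
by rewrite mulSnr big_split_ord IHn big_ord_recr.
Qed.

(** The partial sum [F n] lies between [n %/ L] and [n %/ L + 1] times [C], so each window sum
    [F (i + M) - F i] lies between [M %/ L - 1] and [M %/ L + 2] times [C]. *)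
Lemma block_sums_discrepancy (f : nat -> nat) (L C : nat) :
  0 < L -> (forall q, \sum_(j < L) f (q * L + j) = C) ->
  forall i i' M, \sum_(j < M) f (i + j) <= \sum_(j < M) f (i' + j) + 3 * C.
Proof.
move=> L0 fC i i' M.
pose F n := \sum_(j < n) f j.
have FD s n : F (s + n) = F s + \sum_(j < n) f (s + j).
  by rewrite /F big_split_ord.
have Fq q : F (q * L) = q * C.
  by elim: q => [|q IHq]; [rewrite /F big_ord0 | rewrite mulSnr FD IHq fC mulSnr].
have Fmono s n : s <= n -> F s <= F n by move=> /subnKC <-; rewrite FD leq_addr.
have Flb n : (n %/ L) * C <= F n by rewrite -Fq Fmono // leq_divM.
have Fub n : F n <= (n %/ L).+1 * C by rewrite -Fq Fmono // ltnW // ltn_ceil.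
have divD s : s %/ L + M %/ L <= (s + M) %/ L <= (s %/ L + M %/ L).+1.
  rewrite leq_divRL // mulnDl leq_add ?leq_divM //= -ltnS ltn_divLR //.
  have := ltn_ceil s L0; have := ltn_ceil M L0; nia.
have := Flb i; have := Fub i'; have := Fub (i + M); have := Flb (i' + M).
rewrite !FD; have := divD i; have := divD i'; nia.
Qed.

(** * Windows of an infinite word and occurrences in them *)

Definition window (A : Type) (x : nat -> A) (i m : nat) : seq A :=
  mkseq (fun j => x (i + j)) m.

Lemma size_window (A : Type) (x : nat -> A) i m : size (window x i m) = m.
Proof. exact: size_mkseq. Qed.

Lemma nth_window (A : Type) (x : nat -> A) x0 i m j :
  j < m -> nth x0 (window x i m) j = x (i + j).
Proof. by move=> jm; rewrite nth_mkseq. Qed.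

Lemma drop_window (A : Type) (x : nat -> A) i m j :
  drop j (window x i m) = window x (i + j) (m - j).
Proof.
case: (leqP m j) => mj.
  by rewrite drop_oversize ?size_window // (eqP mj).
have x0 := x 0.
apply: (@eq_from_nth _ x0) => [|l]; rewrite size_drop !size_window // => lm.
by rewrite nth_drop !nth_window ?addnA //; lia.
Qed.

Lemma take_window (A : Type) (x : nat -> A) i m j :
  j <= m -> take j (window x i m) = window x i j.
Proof.
move=> jm; have x0 := x 0.
apply: (@eq_from_nth _ x0) => [|l]; rewrite size_takel ?size_window // => lj.
by rewrite nth_take // !nth_window //; lia.
Qed.

Lemma prefix_window (A : eqType) (x : nat -> A) i m w :
  prefix w (window x i m) = (size w <= m) && (window x i (size w) == w).
Proof.
case: leqP => wm /=; first by rewrite prefixE take_window.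
by apply/negbTE/negP => /size_prefix; rewrite size_window leqNgt wm.
Qed.

Lemma occ_window (A : eqType) (x : nat -> A) (w : seq A) i m :
  occ w (window x i m) =
  \sum_(j < m.+1 - size w) (window x (i + j) (size w) == w).
Proof.
rewrite /occ size_window -sum1_count.
rewrite -[in LHS]/(index_iota 0 m.+1) (big_mkord _ (fun=> 1)) big_mkcond /=.
rewrite (big_ord_widen_cond m.+1 xpredT
  (fun j => nat_of_bool (window x (i + j) (size w) == w))) ?leq_subr //.
rewrite [RHS]big_mkcond /=; apply: eq_bigr => j _.
rewrite drop_window prefix_window ltn_subRL.
have -> : (size w + j < m.+1) = (size w <= m - j) by have := ltn_ord j; lia.
by case: (size w <= _); case: eqP.
Qed.

(** Occurrences of [w] in a factor form a window sum of the indicator of the positions where [w]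
    starts, so bounded discrepancy of block sums applies. *)
Lemma factor_balanced_blocks (A : eqType) (x : nat -> A) :
  (forall w : seq A, exists2 L, 0 < L & exists C, forall q,
     \sum_(j < L) (window x (q * L + j) (size w) == w) = C) ->
  factor_balanced x.
Proof.
move=> H w; have [L L0 [C wC]] := H w.
(* The successor keeps the bound positive when [C = 0]. *)
exists (3 * C).+1 => // u v [i ->] [i' ->]; rewrite !size_mkseq => ->.
rewrite !occ_window.
have D := @block_sums_discrepancy
  (fun j => window x j (size w) == w) L C L0 wC.
by have := D i i' ((size v).+1 - size w); have := D i' i ((size v).+1 - size w); lia.
Qed.

(** * Substitutions of constant length *)

Lemma substitution_cat (A B : Type) (f : A -> seq B) (y z : seq A) :
  substitution f (y ++ z) = substitution f y ++ substitution f z.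
Proof. by rewrite /substitution map_cat flatten_cat. Qed.

Lemma substitution1 (A B : Type) (f : A -> seq B) (a : A) :
  substitution f [:: a] = f a.
Proof. by rewrite /substitution /= cats0. Qed.

Lemma size_substitution (A B : Type) (f : A -> seq B) (l : nat) (y : seq A) :
  (forall a, size (f a) = l) -> size (substitution f y) = size y * l.
Proof.
move=> size_f; elim: y => //= a y IHy.
by rewrite /substitution /= size_cat size_f -/(substitution f y) IHy mulSn.
Qed.

Lemma nth_substitution (A B : Type) (f : A -> seq B) (l : nat)
    (b0 : B) (a0 : A) (y : seq A) (j i : nat) :
  (forall a, size (f a) = l) -> j < size y -> i < l ->
  nth b0 (substitution f y) (j * l + i) = nth b0 (f (nth a0 y j)) i.
Proof.
move=> size_f; elim: y j => //= a y IHy [|j] jy il.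
  by rewrite /substitution /= nth_cat size_f il.
rewrite /substitution /= nth_cat size_f ifN -?leqNgt ?mulSn -?addnA ?leq_addr //.
by rewrite addKn; exact: IHy.
Qed.

Lemma substitution_inj (A : Type) (B : eqType) (f : A -> seq B) (l : nat) :
  (forall a, size (f a) = l) -> 0 < l -> injective f ->
  injective (substitution f).
Proof.
move=> size_f l0 f_inj y z; elim: y z => [|a y IHy] [|b z] //.
- by move/(congr1 size); rewrite !(size_substitution _ size_f) /=; lia.
- by move/(congr1 size); rewrite !(size_substitution _ size_f) /=; lia.
move=> /eqP; rewrite /substitution /= eqseq_cat ?size_f //.
by move=> /andP[/eqP/f_inj-> /eqP/IHy->].
Qed.

(** * Alphabets and block lengths of a construction *)

(** Over a single letter, [cv n ++ cu n] would be the power of that letter with exponent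
    [2 * cr c n >= 2]. *)
Lemma card_alphabet_gt1 (A0 : finType) (c : construction A0) n :
  1 <= n -> 1 < #|alphabet A0 (cB c) n|.
Proof.
move=> n1; rewrite ltnNge; apply/negP => /card_le1_eqP A1.
apply: (@cvu_primitive _ c n n1 [:: ca c n] (2 * cr c n)).
  by have := cr_gt0 c n; lia.
rewrite /wpow; set s := cv c n ++ cu c n.
have -> : flatten (nseq (2 * cr c n) [:: ca c n]) = nseq (2 * cr c n) (ca c n).
  by elim: (2 * _) => //= m ->.
have <- : size s = 2 * cr c n.
  by rewrite size_cat size_cv // size_cu // mul2n addnn.
by apply/all_pred1P/allP => a _; apply/eqP/A1.
Qed.

Definition block_size (A0 : finType) (c : construction A0) (n : nat) : nat :=
  if n is 0 then 1 else #|alphabet A0 (cB c) n| * ck c n.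

Lemma ctau_block (A0 : finType) (c : construction A0) n
    (a : alphabet A0 (cB c) n.+1) : 1 <= n ->
  block_words (cu c n) (cv c n) (ck c n) (ctau a).
Proof. by move=> n1; have [H _ _] := ctau_bij c n1; exact: (H a). Qed.

Lemma size_ctau (A0 : finType) (c : construction A0) n
    (a : alphabet A0 (cB c) n.+1) : size (ctau a) = block_size c n.
Proof.
case: n a => [|n] a; first by rewrite ctau0.
by have [_ _ /size_constant_count] := ctau_block a isT.
Qed.

Lemma ctau_inj (A0 : finType) (c : construction A0) n :
  injective (@ctau _ c n).
Proof.
case: n => [|n] a b; first by rewrite !ctau0 => -[].
by have [_ H _] := @ctau_bij _ c n.+1 isT; apply: H; rewrite inE.
Qed.

Lemma block_size_gt1 (A0 : finType) (c : construction A0) n :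
  1 < block_size c n.+1.
Proof.
by have := @card_alphabet_gt1 _ c n.+1 isT; have := ck_gt0 c n.+1; rewrite /=; nia.
Qed.

Lemma block_size_gt0 (A0 : finType) (c : construction A0) n : 0 < block_size c n.
Proof. by case: n => // n; exact/ltnW/block_size_gt1. Qed.

Lemma head_ctau (A0 : finType) (c : construction A0) n
    (a : alphabet A0 (cB c) n.+1) :
  1 <= n -> exists y, ctau a = ca c n :: y.
Proof.
move=> n1; have [/prefixP[y ->] _ _] := ctau_block a n1.
have := ca_first c n1; case: (cu c n) => // b u /= [->].
by exists (u ++ y).
Qed.

(** This is [L_n], the common length of the images of letters under [tau_0 o ... o tau_n]. *)
Definition total_size (A0 : finType) (c : construction A0) (n : nat) : nat :=
  \prod_(i < n.+1) block_size c i.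

Lemma total_sizeS (A0 : finType) (c : construction A0) n :
  total_size c n.+1 = block_size c n.+1 * total_size c n.
Proof. by rewrite /total_size big_ord_recr mulnC. Qed.

Lemma total_size_gt (A0 : finType) (c : construction A0) n : n < total_size c n.
Proof.
elim: n => [|n IHn]; first by rewrite /total_size big_ord_recr big_ord0.
by rewrite total_sizeS; have := block_size_gt1 c n; nia.
Qed.

Lemma total_size_gt0 (A0 : finType) (c : construction A0) n : 0 < total_size c n.
Proof. by have := total_size_gt c n; lia. Qed.

(** * Iterated substitutions *)

Lemma tau_compS (A0 : finType) (c : construction A0) n y :
  @tau_comp A0 c n.+1 y = tau_comp (substitution (@ctau _ c n.+1) y).
Proof. by []. Qed.

Lemma tau_comp_cat (A0 : finType) (c : construction A0) n
    (y z : seq (alphabet A0 (cB c) n.+1)) :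
  tau_comp (y ++ z) = tau_comp y ++ tau_comp z.
Proof.
by elim: n y z => [|n IHn] y z; rewrite ?tau_compS /= substitution_cat ?IHn.
Qed.

Lemma tau_compE (A0 : finType) (c : construction A0) n
    (y : seq (alphabet A0 (cB c) n.+1)) :
  tau_comp y = substitution (fun a => tau_comp [:: a]) y.
Proof.
elim: y => [|a y IHy]; last by rewrite -cat1s tau_comp_cat IHy.
by elim: n => // n IHn; rewrite tau_compS.
Qed.

Lemma size_tau_comp (A0 : finType) (c : construction A0) n
    (y : seq (alphabet A0 (cB c) n.+1)) :
  size (tau_comp y) = size y * total_size c n.
Proof.
elim: n y => [|n IHn] y.
  rewrite (size_substitution _ (@size_ctau _ c 0)).
  by rewrite /total_size big_ord1.
by rewrite tau_compS IHn (size_substitution _ (@size_ctau _ c n.+1)) total_sizeS mulnA.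
Qed.

Lemma size_tau_comp1 (A0 : finType) (c : construction A0) n
    (a : alphabet A0 (cB c) n.+1) :
  size (tau_comp [:: a]) = total_size c n.
Proof. by rewrite size_tau_comp mul1n. Qed.

Lemma nth_tau_comp (A0 : finType) (c : construction A0) n x0 a0
    (y : seq (alphabet A0 (cB c) n.+1)) j i :
  j < size y -> i < total_size c n ->
  nth x0 (tau_comp y) (j * total_size c n + i) =
  nth x0 (tau_comp [:: nth a0 y j]) i.
Proof.
by move=> jy iL; rewrite tau_compE
  (nth_substitution _ a0 (@size_tau_comp1 _ c n)).
Qed.

Lemma tau_comp_inj (A0 : finType) (c : construction A0) n :
  injective (@tau_comp A0 c n).
Proof.
elim: n => [|n IHn] y z.
  apply: (substitution_inj (@size_ctau _ c 0)) => //; exact: ctau_inj.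
rewrite !tau_compS => /IHn; apply: (substitution_inj (@size_ctau _ c n.+1)).
  exact: block_size_gt0.
exact: ctau_inj.
Qed.

Lemma tau_comp_coarsen (A0 : finType) (c : construction A0) n N
    (z : seq (alphabet A0 (cB c) N.+1)) :
  n <= N -> exists y : seq (alphabet A0 (cB c) n.+1), tau_comp z = tau_comp y.
Proof.
(* Writing [N] as [(N - n) + n] lets the type of [z] follow an induction on the difference. *)
move=> nN; rewrite -(subnK nN) in z *; elim: (N - n) z => [|m IHm] z; first by exists z.
exact: (IHm (substitution (@ctau _ c (m + n).+1) z)).
Qed.

(** Every [ctau a] begins with [ca c n.+1]. This nesting gives both the existence of the limit and
    the shared prefix used for balance. *)
Lemma prefix_tau_comp (A0 : finType) (c : construction A0) n
    (a : alphabet A0 (cB c) n.+2) :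
  prefix (tau_comp [:: ca c n.+1]) (tau_comp [:: a]).
Proof.
rewrite tau_compS substitution1; have [y ->] := head_ctau a isT.
by rewrite -(cat1s _ y) tau_comp_cat prefix_prefix.
Qed.

(** * The limit word and its block decomposition *)

(** Letter [i] is read in the block of level [i], whose length exceeds [i]; the default [ca c 1] is
    never reached. *)
Definition limit_word (A0 : finType) (c : construction A0) (i : nat) : A0 :=
  nth (ca c 1) (tau_comp [:: ca c i.+1]) i.

Lemma prefix_tau_comp_le (A0 : finType) (c : construction A0) n N :
  n <= N -> prefix (tau_comp [:: ca c n.+1]) (tau_comp [:: ca c N.+1]).
Proof.
move=> nN; rewrite -(subnK nN); elim: (N - n) => [|m]; first exact: prefix_refl.
by move=> /prefix_trans; apply; exact: (@prefix_tau_comp _ c (m + n)).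
Qed.

Lemma limit_wordE (A0 : finType) (c : construction A0) n :
  window (limit_word c) 0 (total_size c n) = tau_comp [:: ca c n.+1].
Proof.
apply: (@eq_from_nth _ (ca c 1)) => [|i].
  by rewrite size_window size_tau_comp1.
rewrite size_window => iL; rewrite nth_window // add0n /limit_word.
have iLi := total_size_gt c i.
(* Of the blocks of levels [n] and [i], the lower one is a prefix of the other, and both cover
   position [i]. *)
have [/(prefix_tau_comp_le c)/prefixP[y ->]|/ltnW/(prefix_tau_comp_le c)/prefixP[y ->]]
  := leqP n i; by rewrite nth_cat size_tau_comp1 ?iL ?iLi.
Qed.

Lemma limit_wordP (A0 : finType) (c : construction A0) :
  is_limit_word c (limit_word c).
Proof.
move=> m; exists m => // n /= mn.
rewrite -limit_wordE -[mkseq _ _]/(window (limit_word c) 0 m).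
by rewrite prefix_window size_window eqxx andbT; have := total_size_gt c n; lia.
Qed.

Lemma window_block (A0 : finType) (c : construction A0) n i a0
    (y : seq (alphabet A0 (cB c) n.+1)) j :
  window (limit_word c) i (size y * total_size c n) = tau_comp y ->
  j < size y ->
  window (limit_word c) (i + j * total_size c n) (total_size c n) =
  tau_comp [:: nth a0 y j].
Proof.
move=> xy jy; have x0 := ca c 1.
apply: (@eq_from_nth _ x0); first by rewrite size_window size_tau_comp1.
rewrite size_window => l lL; rewrite nth_window // -nth_tau_comp // -xy.
rewrite nth_window ?addnA // (leq_trans _ (leq_mul jy (leqnn _))) //.
by rewrite mulSnr ltn_add2l.
Qed.

Lemma limit_word_block (A0 : finType) (c : construction A0) n q :
  exists a : alphabet A0 (cB c) n.+1,
    window (limit_word c) (q * total_size c n) (total_size c n) =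
    tau_comp [:: a].
Proof.
(* The initial block of level [N] is longer than [N], hence covers the [q]-th block of level [n];
   [n <= N] allows coarsening it to level [n]. *)
pose N := maxn n (q.+1 * total_size c n).
have [y yE] := @tau_comp_coarsen _ c n N [:: ca c N.+1] (leq_maxl _ _).
have := size_tau_comp y; rewrite -yE size_tau_comp1 => szy.
exists (nth (ca c n.+1) y q).
rewrite -[q * _]add0n; apply: window_block.
  by rewrite -szy limit_wordE.
have := total_size_gt c N; rewrite szy => /(leq_ltn_trans (leq_maxr _ _)).
by rewrite ltn_pmul2r ?total_size_gt0 // => /ltnW.
Qed.

(** * Balance of the limit word *)

Lemma limit_word_balanced (A0 : finType) (c : construction A0) :
  factor_balanced (limit_word c).
Proof.
apply: factor_balanced_blocks => w; set x := limit_word c.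
pose m := size w; pose L n := total_size c n.
have wL : size w <= L m by exact/ltnW/total_size_gt.
exists (L m.+2); first exact: total_size_gt0.
(* [P] is the prefix shared by all blocks of level [m+1]. As [size w <= size P], the block of [a]
   followed by [P] determines every occurrence of [w] starting in that block. *)
pose P := tau_comp [:: ca c m.+1].
pose g (a : alphabet A0 (cB c) m.+2) : nat :=
  \sum_(j < L m.+1) (take (size w) (drop j (tau_comp [:: a] ++ P)) == w).
have gE i a : window x i (L m.+1) = tau_comp [:: a] ->
    window x (i + L m.+1) (L m) = P ->
    \sum_(j < L m.+1) (window x (i + j) (size w) == w) = g a.
  move=> xa xP; rewrite /g; have -> : tau_comp [:: a] ++ P = window x i (L m.+1 + L m).
    rewrite -(cat_take_drop (L m.+1) (window x i (L m.+1 + L m))).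
    by rewrite take_window ?leq_addr // drop_window addKn xa xP.
  apply: eq_bigr => j _; rewrite drop_window take_window //.
  by have := ltn_ord j; lia.
have xP q : window x (q * L m.+1) (L m) = P.
  have [a xa] := limit_word_block c m.+1 q.
  have Lm : L m <= L m.+1 by rewrite /L total_sizeS leq_pmull ?block_size_gt0.
  rewrite -(take_window x (q * L m.+1) Lm) /x xa.
  have /prefixP[y ->] := prefix_tau_comp a.
  by rewrite take_size_cat // size_tau_comp1.
exists (\sum_a ck c m.+2 * g a) => q.
have [b] := limit_word_block c m.+2 q.
rewrite tau_compS substitution1 total_sizeS -(size_ctau b) => xb.
have [_ _ countb] := ctau_block b isT.
(* Reading the constant [ck c m.+2] as a letter count of [ctau b] turns the sum over letters into a
   sum over positions of [ctau b]. *)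
under eq_bigr => a _ do rewrite -(countb a).
rewrite -sum_count_mem (big_nth (ca c m.+2)) big_mkord.
rewrite /L total_sizeS -(size_ctau b).
rewrite (@sum_ord_mul (fun j => window x (q * _ + j) (size w) == w)).
apply: eq_bigr => j _.
under eq_bigr => l _ do rewrite addnA.
apply: gE; first exact: window_block.
(* The next block also starts at a multiple of [L m.+1], so [P] follows even the last block inside
   [b]. *)
have -> : q * (size (ctau b) * total_size c m.+1) + j * L m.+1 + L m.+1 =
    (q * size (ctau b) + j.+1) * L m.+1 by rewrite mulnDl mulSnr mulnA addnA.
exact: xP.
Qed.

(** * Factor complexity and its growth rate *)

Lemma is_factorP (A : Type) (x : nat -> A) n (u : n.-tuple A) :
  is_factor x u <-> exists i, forall j : 'I_n, tnth u j = x (i + j).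
Proof.
split=> -[i ui]; exists i.
  by move=> j; rewrite (tnth_nth (x 0)) ui size_tuple nth_mkseq.
apply: (@eq_from_nth _ (x 0)); first by rewrite size_mkseq.
rewrite size_tuple => j jn.
by rewrite -[j]/(val (Ordinal jn)) -tnth_nth ui nth_mkseq.
Qed.

Lemma factor_complexity_gt0 (A : finType) (x : nat -> A) n :
  0 < factor_complexity x n.
Proof.
apply/card_gt0P; exists [tuple x i | i < n]; apply/asboolP; rewrite is_factorP.
by exists 0 => j; rewrite tnth_mktuple.
Qed.

(** Cutting a factor after [m] letters is injective into pairs of factors. *)
Lemma factor_complexityD (A : finType) (x : nat -> A) m n :
  factor_complexity x (m + n) <= factor_complexity x m * factor_complexity x n.
Proof.
pose f (u : (m + n).-tuple A) :=
  ([tuple tnth u (lshift n i) | i < m], [tuple tnth u (rshift m i) | i < n]).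
have f_inj : injective f.
  move=> u v uv; apply: eq_from_tnth => i; case: (split_ordP i) => j ->.
    by have := congr1 (fun p => tnth p.1 j) uv; rewrite !tnth_mktuple.
  by have := congr1 (fun p => tnth p.2 j) uv; rewrite !tnth_mktuple.
rewrite /factor_complexity -cardX -(fintype.card_image f_inj).
apply/subset_leq_card/fintype.subsetP => _ /fintype.imageP[u + ->].
rewrite !inE => ux; have [i ui] := (is_factorP x u).1 ux.
apply/andP; split; apply/asboolP; apply: (is_factorP _ _).2;
  [exists i|exists (i + m)] => j;
  by rewrite tnth_mktuple ui ?addnA.
Qed.

(** Distinct letters have distinct images, and each image is a factor: since [ck c n.+1 > 0], every
    letter occurs in every [ctau b] of level [n+1]. *)
Lemma factor_complexity_total_size (A0 : finType) (c : construction A0) n :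
  #|alphabet A0 (cB c) n.+1| <= factor_complexity (limit_word c) (total_size c n).
Proof.
pose f (a : alphabet A0 (cB c) n.+1) : (total_size c n).-tuple A0 :=
  @Tuple _ _ (tau_comp [:: a]) (introT eqP (size_tau_comp1 a)).
have f_inj : injective f by move=> a b /(congr1 val) /= /tau_comp_inj[].
rewrite /factor_complexity -(fintype.card_image f_inj).
apply/subset_leq_card/fintype.subsetP => _ /fintype.imageP[a _ ->].
suff: is_factor (limit_word c) (f a) by move=> /asboolT.
rewrite /is_factor size_tau_comp1 /=.
have [b] := limit_word_block c n.+1 0.
rewrite tau_compS substitution1 total_sizeS -(size_ctau b) => xb.
have [_ _ /(_ a) countb] := ctau_block b isT.
have ab : a \in ctau b by rewrite -has_pred1 has_count countb ck_gt0.
have := window_block a xb (_ : index a (ctau b) < _).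
by rewrite index_mem nth_index // => /(_ ab) xa; eexists; rewrite -xa.
Qed.

Local Open Scope ring_scope.

Lemma fekete (R : realType) (u : nat -> R) :
  (forall n, 0 <= u n) -> (forall m n, u (m + n)%N <= u m + u n) ->
  ((n%:R)^-1 * u n @[n --> \oo] --> inf (range (fun n => n.+1%:R^-1 * u n.+1)))%classic.
Proof.
move=> u0 uD; set S := range _; set l := inf S.
have lbS : has_lbound S.
  by exists 0 => _ [n _ <-]; rewrite mulr_ge0 // invr_ge0.
have S0 : (S !=set0)%classic by exists (1%:R^-1 * u 1%N), 0%N.
have uM q m r : u (q * m + r)%N <= q%:R * u m + u r.
  elim: q => [|q IHq]; first by rewrite mul0r add0r.
  rewrite mulSn -addnA (le_trans (uD _ _)) // -natr1 mulrDl mul1r.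
  by rewrite [_ + u m]addrC -addrA lerD2l.
apply/cvgrPdist_le => e e0.
have e20 : 0 < e / 2 by rewrite divr_gt0.
have [_ [m _ <-] ml] := inf_adherent e20 (conj S0 lbS).
(* [B] dominates [u r] for every remainder [r] modulo [m.+1], and [B / n] vanishes in the limit. *)
pose B := \sum_(r < m.+1) u r.
have B0 : 0 <= B by exact: sumr_ge0.
near=> n.
have n0 : (0 < n)%N by near: n; exact: nbhs_infty_gt.
have n0R : 0 < n%:R :> R by rewrite ltr0n.
have Sn : S (n%:R^-1 * u n) by exists n.-1; rewrite // prednK.
have ln := ge_inf lbS Sn.
rewrite distrC ger0_norm ?subr_ge0 // lerBlDl.
have Bn : n%:R^-1 * B <= e / 2.
  rewrite mulrC ler_pdivrMr // mulrC -ler_pdivrMr ?divr_gt0 //.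
  by near: n; exact: nbhs_infty_ger.
have un : u n <= (n %/ m.+1)%:R * u m.+1 + B.
  rewrite {1}(divn_eq n m.+1) (le_trans (uM _ _ _)) // lerD2l /B.
  by rewrite (bigD1 (inord (n %% m.+1))) //= inordK ?ltn_pmod // lerDl sumr_ge0.
have qn : n%:R^-1 * ((n %/ m.+1)%:R * u m.+1) <= m.+1%:R^-1 * u m.+1.
  rewrite mulrA ler_wpM2r // ler_pdivrMl // ler_pdivlMr ?ltr0n //.
  by rewrite -natrM ler_nat leq_divM.
have un' : n%:R^-1 * u n <= n%:R^-1 * ((n %/ m.+1)%:R * u m.+1) + n%:R^-1 * B.
  by rewrite -mulrDr ler_wpM2l ?invr_ge0.
by rewrite (le_trans un') // (splitr e) addrA lerD // (le_trans qn) // ltW.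
Unshelve. all: by end_near.
Qed.

(** Subadditivity of the logarithm gives the limit; along the lengths [l * E] the ratio is at least
    [ln 2 / l], so the limit is too. *)
Lemma exponential_complexityP (R : realType) (A : finType) (x : nat -> A) (l : nat) :
  (0 < l)%N ->
  (forall N, exists2 E, N <= E & 2 ^ E <= factor_complexity x (l * E))%N ->
  exponential_complexity R x.
Proof.
move=> l0 xE; pose u n : R := ln (factor_complexity x n)%:R.
have p1 n : 1 <= (factor_complexity x n)%:R :> R.
  by rewrite ler1n factor_complexity_gt0.
have p0 n : 0 < (factor_complexity x n)%:R :> R by exact: lt_le_trans (p1 n).
have u0 n : 0 <= u n by exact: ln_ge0.
have uD m n : u (m + n)%N <= u m + u n.
  rewrite /u -lnM ?posrE // -natrM ler_ln ?posrE //;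
    last by rewrite natrM mulr_gt0.
  by rewrite ler_nat factor_complexityD.
have := fekete u0 uD; set h := inf _ => uh.
exists h => //; apply: (@lt_le_trans _ _ (l%:R^-1 * ln 2)).
  by rewrite mulr_gt0 ?invr_gt0 ?ltr0n // ln_gt0 // ltr1n.
rewrite leNgt; apply/negP => /(cvgr_lt _ uh)[N _ Nu].
have [E NE pE] := xE N.+1.
have E0 : (0 < E)%N by exact: leq_trans NE.
have /Nu : (N <= l * E)%N by rewrite (leq_trans (ltnW NE)) // leq_pmull.
apply/negP; rewrite -leNgt natrM invfM -mulrA ler_wpM2l ?invr_ge0 //.
rewrite ler_pdivlMl ?ltr0n // mulrC mulr_natr -lnXn //.
by rewrite /u ler_ln ?posrE ?exprn_gt0 // -natrX ler_nat.
Qed.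

Local Close Scope ring_scope.

(** * Enumerating and counting the words of [W_n] for one-letter [u_n] and [v_n] *)

Definition block_list (T : finType) (a b : T) (k : nat) : seq (seq T) :=
  [seq val t | t <- enum [pred t : (#|T| * k).-tuple T |
    [&& prefix [:: a] t, suffix [:: b] t & [forall c, count_mem c t == k]]]].

Lemma block_list_uniq (T : finType) (a b : T) k : uniq (block_list a b k).
Proof. by rewrite map_inj_uniq ?enum_uniq //; exact: val_inj. Qed.

Lemma block_listP (T : finType) (a b : T) k w :
  w \in block_list a b k <-> block_words [:: a] [:: b] k w.
Proof.
split=> [/mapP[t]|[pw sw cw]].
  by rewrite mem_enum inE => /and3P[pt st /forallP ct] ->; split=> // c; exact/eqP.
have szw : size w == #|T| * k by apply/eqP/size_constant_count.
apply/mapP; exists (Tuple szw) => //; rewrite mem_enum inE pw sw.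
by apply/forallP => c; rewrite cw.
Qed.

Lemma nth_block_list_bij (T : finType) (a b : T) k m :
  size (block_list a b k) = m ->
  set_bij [set: 'I_m] (block_words [:: a] [:: b] k)
    (fun i : 'I_m => nth [::] (block_list a b k) i).
Proof.
move=> szm; split.
- by move=> i _ /=; apply/block_listP; rewrite mem_nth // szm.
- move=> i j _ _ /eqP; rewrite nth_uniq ?szm ?block_list_uniq // => /eqP.
  exact: val_inj.
- move=> w /block_listP wl; have wm : index w (block_list a b k) < m.
    by rewrite -szm index_mem.
  by exists (Ordinal wm) => //=; rewrite nth_index.
Qed.

Lemma count_flatten_nseq (T : eqType) (k : nat) (s : seq T) (c : T) :
  uniq s -> count_mem c (flatten [seq nseq k d | d <- s]) = (c \in s) * k.
Proof.
elim: s => //= d s IHs /andP[ds us]; rewrite count_cat IHs // count_nseq /= inE.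
rewrite eq_sym; case: eqVneq => [->|_]; last by rewrite mul0n.
by rewrite (negPf ds) mul0n addn0.
Qed.

Lemma mem_rem2_enum (T : finType) (a b c : T) :
  (c \in rem b (rem a (enum T))) = (c != b) && (c != a).
Proof.
by rewrite mem_rem_uniq ?rem_uniq ?enum_uniq // inE mem_rem_uniq ?enum_uniq //
  inE mem_enum andbT.
Qed.

(** This serves the first level, where the alphabet may have only two letters. The words [w i] are
    told apart by the position [i.+1] of their first [b]; [2 <= k] leaves a [b] for the end. *)
Lemma size_block_list_ge (T : finType) (a b : T) k :
  a != b -> 2 <= k -> k <= size (block_list a b k).
Proof.
move=> ab k2.
pose rest := flatten [seq nseq k d | d <- rem b (rem a (enum T))].
pose w i := nseq i.+1 a ++ b :: nseq (k - i.+1) a ++ rest ++ nseq k.-1 b.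
rewrite -[leqLHS](size_iota 0) -(size_map w); apply: uniq_leq_size.
  rewrite map_inj_uniq ?iota_uniq // => i j.
  have wb l : index b (w l) = l.+1.
    by rewrite index_cat mem_nseq eq_sym (negPf ab) size_nseq /= eqxx addn0.
  by move=> /(congr1 (index b)); rewrite !wb => -[].
move=> _ /mapP[i + ->]; rewrite mem_iota add0n => /andP[_ ik].
apply/block_listP; split.
- by rewrite /w /= eqxx prefix0s.
- rewrite /w (_ : k.-1 = k.-2 + 1); last by lia.
  by rewrite nseqD !catA -cat_cons !catA suffix_suffix.
- move=> c; rewrite /w !count_cat /= !count_cat !count_nseq /=.
  rewrite count_flatten_nseq ?rem_uniq ?enum_uniq // mem_rem2_enum.
  rewrite (eq_sym a c) (eq_sym b c).
  case: (eqVneq c a) => [->|ca]; first by rewrite (negPf ab) /=; lia.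
  by case: (eqVneq c b) => [_|_] /=; lia.
Qed.

(** Any permutation of the other letters may stand between [a] and [b]. *)
Lemma size_block_list1_ge (T : finType) (a b : T) :
  a != b -> (#|T| - 2)`! <= size (block_list a b 1).
Proof.
move=> ab; pose s := rem b (rem a (enum T)).
have us : uniq s by rewrite !rem_uniq ?enum_uniq.
have bs : b \in rem a (enum T).
  by rewrite mem_rem_uniq ?enum_uniq // !inE eq_sym ab mem_enum.
have szs : size s = #|T| - 2.
  by rewrite size_rem // size_rem ?mem_enum // cardE subn2.
rewrite -szs -size_permutations //.
rewrite -(size_map (fun t => a :: rcons t b) (permutations s)).
apply: uniq_leq_size.
  rewrite map_inj_uniq ?permutations_uniq // => t t' [].
  by move=> /rcons_inj[].
move=> _ /mapP[t + ->]; rewrite mem_permutations => /permP ts.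
apply/block_listP; split.
- by rewrite /= eqxx prefix0s.
- by rewrite -cats1 -cat_cons suffix_suffix.
- move=> c; rewrite -cats1 /= count_cat ts /= count_uniq_mem //.
  rewrite mem_rem2_enum.
  rewrite (eq_sym a c) (eq_sym b c).
  case: (eqVneq c a) => [->|ca]; first by rewrite (negPf ab).
  by case: (eqVneq c b).
Qed.

(** * Factorial estimates *)

Lemma bin_leq_exp2 n m : 'C(n, m) <= 2 ^ n.
Proof.
elim: n m => [|n IHn] [|m] //; first by rewrite bin0 expn_gt0.
by rewrite binS expnS mul2n -addnn leq_add.
Qed.

Lemma expn_self_leq d : 2 <= d -> d ^ d <= 16 ^ d * (d - 2)`!.
Proof.
move=> d2.
(* The falling factorial [(2 * d) ^_ d] has [d] factors, all at least [d], and equals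
   ['C(2 * d, d) * d!]. *)
have dd : d ^ d <= 4 ^ d * d`!.
  apply: (@leq_trans ((2 * d) ^_ d)).
    rewrite ffact_prod -[X in _ ^ X]card_ord -prod_nat_const.
    by apply: leq_prod => i _; have := ltn_ord i; lia.
  by rewrite -bin_ffact leq_mul2r -(expnM 2 2) bin_leq_exp2 orbT.
have d4 : d * d.-1 <= 4 ^ d.
  have := ltn_expl d (isT : 1 < 2); rewrite (expnMn 2 2) => d2d.
  by apply: leq_mul; lia.
rewrite (leq_trans dd) // (expnMn 4 4) -mulnA leq_mul2l.
have -> : d`! = d * d.-1 * (d - 2)`!.
  by case: d d2 {dd d4} => [|[|d]] //= _; rewrite subn2 /= !factS mulnA.
by rewrite leq_mul2r d4 !orbT.
Qed.

(* The constant [256 = 16 ^ 2] absorbs the loss [16 ^ d] of [expn_self_leq]. *)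
Lemma fact_growth d E : 256 * 2 ^ E <= d -> 256 * 2 ^ (d * E) <= (d - 2)`!.
Proof.
move=> dE; have E0 : 0 < 2 ^ E by rewrite expn_gt0.
have d2 : 2 <= d by lia.
rewrite -(@leq_pmul2l (16 ^ d)) ?expn_gt0 //.
apply: leq_trans (expn_self_leq d2); apply: (@leq_trans ((256 * 2 ^ E) ^ d)).
  rewrite expnMn -(expnM 2) (mulnC E) mulnA leq_mul2r (expnMn 16 16) leq_mul2l.
  by rewrite (@leq_exp2l 16 2 d) // d2 !orbT.
by rewrite leq_exp2r //; lia.
Qed.

(** * A construction of exponential complexity *)

(* [level_card m + 2] is the cardinality of [A_(m+2)]. The multiplicity [2 ^ 9]
   makes [A_2] large enough to start the induction of [level_card_ge]; at every
   level the subtraction is not truncated, by [level_card_ge]. *)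
Fixpoint level_card (A0 : finType) (a0 b0 : A0) (m : nat) : nat :=
  if m is m'.+1
  then size (@block_list 'I_(level_card a0 b0 m').+2 ord0 ord_max 1) - 2
  else size (block_list a0 b0 (2 ^ 9)) - 2.

(** The form [_.+2] makes [ord0] and [ord_max] two distinct letters by computation. *)
Definition level_type (A0 : finType) (a0 b0 : A0) (n : nat) : finType :=
  'I_(level_card a0 b0 n.-2).+2.

Definition level_fst (A0 : finType) (a0 b0 : A0) n :
    alphabet A0 (level_type a0 b0) n :=
  match n with 0 | 1 => a0 | m.+2 => ord0 end.

Definition level_snd (A0 : finType) (a0 b0 : A0) n :
    alphabet A0 (level_type a0 b0) n :=
  match n with 0 | 1 => b0 | m.+2 => ord_max end.

Definition level_mult (n : nat) : nat := if n is 1 then 2 ^ 9 else 1.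

Definition level_subst (A0 : finType) (a0 b0 : A0) n :
    alphabet A0 (level_type a0 b0) n.+1 -> seq (alphabet A0 (level_type a0 b0) n) :=
  match n with
  | 0 => fun a : A0 => [:: a]
  | 1 => fun i : 'I_(level_card a0 b0 0).+2 =>
      nth [::] (block_list a0 b0 (2 ^ 9)) i
  | m.+2 => fun i : 'I_(level_card a0 b0 m.+1).+2 =>
      nth [::] (@block_list 'I_(level_card a0 b0 m).+2 ord0 ord_max 1) i
  end.

(* [level_exp m] is the ratio [L_(m+1) / L_1]. *)
Fixpoint level_exp (A0 : finType) (a0 b0 : A0) (m : nat) : nat :=
  if m is m'.+1 then (level_card a0 b0 m').+2 * level_exp a0 b0 m' else 1.

Lemma level_fst_neq_snd (A0 : finType) (a0 b0 : A0) n :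
  a0 != b0 -> level_fst a0 b0 n != level_snd a0 b0 n.
Proof. by case: n => [|[|m]]. Qed.

(** The invariant reproduces itself by [fact_growth]: the next exponent is the present one times the
    cardinality [d], and the next alphabet has at least [(d - 2)!] letters. *)
Lemma level_card_ge (A0 : finType) (a0 b0 : A0) m :
  a0 != b0 -> 256 * 2 ^ level_exp a0 b0 m <= (level_card a0 b0 m).+2.
Proof.
move=> ab; have le_sub2 s : s <= (s - 2).+2 by lia.
elim: m => [|m IHm] /=; apply: leq_trans (le_sub2 _).
  have := size_block_list_ge ab (isT : 2 <= 2 ^ 9).
  by rewrite (_ : 256 * 2 ^ 1 = 2 ^ 9).
have := @size_block_list1_ge 'I_(level_card a0 b0 m).+2 ord0 ord_max isT.
by rewrite card_ord; apply: leq_trans; exact: fact_growth IHm.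
Qed.

(** Here the subtraction in [level_card] is seen to be exact, so that [level_subst] is onto the
    whole block set. *)
Lemma size_block_list_level (A0 : finType) (a0 b0 : A0) n :
  a0 != b0 ->
  size (block_list (level_fst a0 b0 n.+1) (level_snd a0 b0 n.+1) (level_mult n.+1))
  = (level_card a0 b0 n).+2.
Proof.
move=> ab; have E0 : 0 < 2 ^ level_exp a0 b0 n by rewrite expn_gt0.
have : 2 < (level_card a0 b0 n).+2.
  by apply: leq_trans (level_card_ge n ab); lia.
have subK s : 2 < (s - 2).+2 -> s = (s - 2).+2 by lia.
by case: n {E0} => [|n]; exact: subK.
Qed.

Lemma primitive_pair (A : Type) (a b : A) : a <> b -> primitive_word [:: b; a].
Proof.
move=> ab [|c [|d z]] [|[|j]] //= _.
- by rewrite /wpow; elim: j.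
- by move=> [bc ac _]; apply: ab; rewrite ac bc.
- by move/(congr1 size); rewrite /wpow /= size_cat /= addnS.
Qed.

Definition exp_construction (A0 : finType) (a0 b0 : A0) (ab : a0 != b0) :
  construction A0.
Proof.
refine (@Construction A0 level_mult (fun=> 1) _ _ _ (level_type a0 b0)
  (fun n => [:: level_fst a0 b0 n]) (fun n => [:: level_snd a0 b0 n])
  (level_fst a0 b0) (@level_subst A0 a0 b0) _ _ _ _ _ _) => //.
- by case=> [|[|n]].
- by case=> [|[|n]].
- move=> n _; apply: primitive_pair; exact/eqP/level_fst_neq_snd.
- case=> // n _; have := nth_block_list_bij (size_block_list_level n ab).
  by case: n => [|n].
(* Kept transparent: the block lengths are computed from it below. *)
Defined.

Lemma total_size_exp_construction (A0 : finType) (a0 b0 : A0) (ab : a0 != b0) m :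
  total_size (exp_construction ab) m.+1 =
  (#|A0| * 2 ^ 9) * level_exp a0 b0 m.
Proof.
elim: m => [|m IHm]; first by rewrite total_sizeS /total_size big_ord1 /= !muln1.
by rewrite total_sizeS IHm /= card_ord muln1 mulnCA.
Qed.

Theorem theorem7p6 (R : realType) (A0 : finType) :
  (forall c : construction A0,
     exists2 x : nat -> A0, is_limit_word c x & factor_balanced x) /\
  (2 <= #|A0| ->
     exists (c : construction A0) (x : nat -> A0),
       is_limit_word c x /\ exponential_complexity R x).
Proof.
split=> [c|/card_gt1P[a0 [b0 [_ _ ab]]]].
  by exists (limit_word c); [exact: limit_wordP | exact: limit_word_balanced].
pose c := exp_construction ab; exists c, (limit_word c); split.
  exact: limit_wordP.
have A0_gt0 : 0 < #|A0| by apply/card_gt0P; exists a0.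
(* This constant is [L_1], so with [E = level_exp a0 b0 N] the length [l * E] is [L_(N+1)]. *)
apply: (@exponential_complexityP _ _ _ (#|A0| * 2 ^ 9)) => [|N].
  by rewrite muln_gt0 A0_gt0 expn_gt0.
exists (level_exp a0 b0 N).
  (* Each level multiplies the exponent by at least 2, so it exceeds [N]. *)
  apply: ltnW; elim: N => //= N IHN.
  by apply: leq_trans (leq_mul (isT : 2 <= _.+2) IHN); lia.
rewrite -(total_size_exp_construction ab).
apply: leq_trans (factor_complexity_total_size c N.+1).
rewrite card_ord; apply: leq_trans (level_card_ge N ab); exact: leq_pmull.
Qed.
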